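(* The bounded Urysohn space $\mathbb{U}_{\mathbb{Q}_+,\leq 1}$ is divisible.
   Context: The age of a metric space is the class of all finite metric spaces that embed isometrically into it. A metric space is homogeneous if every isometry between two of its finite subspaces extends to an isometry of the space onto itself. $\mathbb{U}_{\mathbb{Q}_+,\leq 1}$ is the countable homogeneous metric space (unique up to isometry) whose age is the class of all finite metric spaces all of whose distances are rational numbers in $[0,1]$. A metric space $\mathbb{M}=(M;d)$ is divisible if there is a partition of $M$ into two parts, neither of which contains an isometric copy of $\mathbb{M}$. *)

(* Defs.v *)
From mathcomp Require Import all_boot all_order all_algebra.
From mathcomp Require Import boolp classical_sets functions cardinality reals.
From mathcomp Require Import topology.

Set Implicit Arguments.
Unset Strict Implicit.
Unset Printing Implicit Defensive.

Import Order.TTheory GRing.Theory Num.Theory.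

Local Open Scope classical_set_scope.
Local Open Scope ring_scope.

Section MetricSpaces.
Context {R : realType}.

Definition isometric_on {M N : metricType R} (A : set M) (f : M -> N) : Prop :=
  forall x y, A x -> A y -> mdist (f x) (f y) = mdist x y.

(* Injectivity is automatic, since distinct points have nonzero distance. *)
Definition isometric_embedding {M N : metricType R} (f : M -> N) : Prop :=
  isometric_on [set: M] f.

Definition finite_space (F : metricType R) : Prop := finite_set [set: F].

Definition age (M F : metricType R) : Prop :=
  finite_space F /\ exists f : F -> M, isometric_embedding f.

(* An isometry between the finite subspaces A and B is represented by a total
   map f : M -> M of which only the restriction to A is relevant. *)
Definition homogeneous (M : metricType R) : Prop :=
  forall (A B : set M) (f : M -> M),
    finite_set A -> finite_set B -> isometric_on A f -> f @` A = B ->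
    exists g : M -> M,
      [/\ isometric_embedding g, range g = [set: M] &
          forall x, A x -> g x = f x].

Definition distances_in (D : set R) (F : metricType R) : Prop :=
  forall x y : F, D (mdist x y).

Definition rational_unit_interval : set R :=
  [set r | 0 <= r <= 1 /\ exists q : rat, r = ratr q].

Definition bounded_rational_Urysohn (U : metricType R) : Prop :=
  [/\ countable [set: U],
      homogeneous U &
      forall F : metricType R,
        age U F <-> finite_space F /\ distances_in rational_unit_interval F].

Definition contains_copy {N : metricType R} (A : set N) (M : metricType R) :
    Prop :=
  exists f : M -> N, isometric_embedding f /\ range f `<=` A.

(* Both parts are necessarily nonempty: if one were empty, the other would be
   all of M and contain the copy M itself. *)
Definition divisible (M : metricType R) : Prop :=
  exists A B : set M,
    [/\ A `|` B = [set: M], A `&` B = set0,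
        ~ contains_copy A M & ~ contains_copy B M].

End MetricSpaces.

(* Main.v *)
Require Import Defs.
From HB Require Import structures.
From mathcomp Require Import all_boot all_order all_algebra.
From mathcomp Require Import boolp classical_sets functions cardinality reals.
From mathcomp Require Import topology.
From mathcomp Require Import lra.
From mathcomp Require Import lra.

(** A countable space in which one can travel far by arbitrarily small steps
    from every point is divisible (divisible_of_far_walks).

    Enumerate the points of M and attach to every point x a centre: the first
    point of the enumeration at distance less than rho from x.  The points with
    centre z lie in the open ball of radius rho around z, and this ball is cut
    into infinitely many concentric rings that get thinner towards the boundary
    sphere.  Colour x by the parity of the index of its ring.

    Let f be an isometric copy of M inside M.  Among the centres of the points
    of the copy, take the first one, z.  Every point of the copy in the ball
    around z then has centre z, so that on this part of the copy the colour is
    governed by the distance to z alone (centres_exist).  Start at a point f p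
    with centre z, say in the ring of index m, and walk inside the copy to a
    point outside the ball by steps shorter than the width of the ring of index
    m + 1.  The walk cannot jump over that ring (first_crossing), so the copy
    meets two consecutive rings and has points of both colours
    (consecutive_levels).

    In the bounded rational Urysohn space such walks exist from every point:
    the path 0, 1/N, 2/N, ..., 1 is a finite space with rational distances in
    the unit interval, so it embeds, and by homogeneity it embeds with any
    prescribed starting point (Urysohn_far_walks). *)

Set Implicit Arguments.
Unset Strict Implicit.
Unset Printing Implicit Defensive.

Import Order.TTheory GRing.Theory Num.Theory.

Local Open Scope classical_set_scope.
Local Open Scope ring_scope.

Definition far_walks (R : realType) (M : metricType R) (r : R) : Prop :=
  forall (p : M) (e : R), 0 < e -> exists (n : nat) (c : nat -> M),
    [/\ c 0 = p, forall i, (i < n)%N -> mdist (c i) (c i.+1) < e &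
        r <= mdist p (c n)].

(** Discrete intermediate value property: at the first index where the
    sequence reaches s, it has not yet reached s + e. *)
Lemma first_crossing (R : realType) (a : nat -> R) (n : nat) (s e : R) :
  a 0 < s -> s <= a n -> (forall i, (i < n)%N -> a i.+1 < a i + e) ->
  exists2 i, (i <= n)%N & s <= a i < s + e.
Proof.
move=> a0s san step.
have [[|i] sai imin] := ex_minnP (ex_intro (fun i => s <= a i) n san).
  by move: sai; rewrite leNgt a0s.
have lt_in : (i < n)%N by exact: imin.
have lt_ais : a i < s.
  by rewrite ltNge; apply/negP => /imin; rewrite ltnn.
exists i.+1 => //; rewrite sai /=.
by have := step i lt_in; lra.
Qed.

(** The centre of x is the first point, in an enumeration of M, at distance
    less than rho from x.  The second property is what this minimality gives
    for a family f of points: the point f p is one whose centre comes first. *)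
Lemma centres_exist (R : realType) (M : metricType R) (rho : R) :
  countable [set: M] -> 0 < rho ->
  exists ctr : M -> M,
    (forall x, mdist x (ctr x) < rho) /\
    forall (T : Type) (f : T -> M), inhabited T ->
      exists p, forall w, mdist (f w) (ctr (f p)) < rho ->
        ctr (f w) = ctr (f p).
Proof.
move=> /countable_injP[e e_inj] rho_gt0.
have {}e_inj x y : e x = e y -> x = y.
  by move=> exy; apply: e_inj; rewrite ?in_setT.
have ctrP x : exists z, mdist x z < rho /\
    forall y, mdist x y < rho -> (e z <= e y)%N.
  have ex_near : exists k, `[< exists y, mdist x y < rho /\ e y = k >].
    by exists (e x); apply/asboolP; exists x; rewrite mdistxx.
  have [k /asboolP[z [xz <-]] zmin] := ex_minnP ex_near.
  by exists z; split=> // y xy; apply: zmin; apply/asboolP; exists y.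
have [ctr ctrE] := choice ctrP.
exists ctr; split=> [x|T f [t0]]; first by have [] := ctrE x.
have ex_ctr : exists k, `[< exists t, e (ctr (f t)) = k >].
  by exists (e (ctr (f t0))); apply/asboolP; exists t0.
have [k /asboolP[p <-] pmin] := ex_minnP ex_ctr.
exists p => w fwp; apply/e_inj/eqP; rewrite eqn_leq.
have [_ ->//] := ctrE (f w).
by apply: pmin; apply/asboolP; exists w.
Qed.

(** The ring of index m in a ball of radius rho is
    rho - 1/m <= d < rho - 1/(m+1), where d is the distance to the centre
    (for m = 0 the first bound is absent).  Infinitely many rings are needed:
    a copy could lie, inside the ball, entirely in an outermost ring. *)
Definition ring_index (R : realType) (rho d : R) : nat :=
  Num.truncn (rho - d)^-1.

Lemma lt_ring_index (R : realType) (rho d : R) : d < rho ->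
  d < rho - (ring_index rho d).+1%:R^-1.
Proof.
move=> d_lt; have gap_gt0 : 0 < rho - d by rewrite subr_gt0.
rewrite ltrBrDr -ltrBrDl.
by rewrite invf_plt ?posrE ?ltr0Sn// truncnS_gt.
Qed.

Lemma ring_index_eq (R : realType) (rho d : R) (m : nat) :
  rho - m.+1%:R^-1 <= d -> d < rho - m.+2%:R^-1 -> ring_index rho d = m.+1.
Proof.
move=> lo hi.
have m2_gt0 : 0 < m.+2%:R^-1 :> R by rewrite invr_gt0 ltr0Sn.
have gap_gt0 : 0 < rho - d.
  by rewrite subr_gt0 (lt_trans hi)// ltrBlDr ltrDl.
apply: truncn_def; apply/andP; split.
  by rewrite invf_pge ?posrE ?ltr0Sn// lerBlDr -lerBlDl.
by rewrite invf_plt ?posrE ?ltr0Sn// ltrBrDr -ltrBrDl.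
Qed.

(** The radius 2 rho of the walks is what makes them leave the ball of radius
    rho around a centre, since they start inside this ball. *)
Lemma consecutive_levels (R : realType) (M : metricType R) (rho : R) :
  countable [set: M] -> inhabited M -> 0 < rho -> far_walks M (2 * rho) ->
  exists level : M -> nat, forall f : M -> M, isometric_embedding f ->
    exists p q, level (f q) = (level (f p)).+1.
Proof.
move=> Mcount M0 rho_gt0 walks.
have [ctr [ctr_near ctr_first]] := centres_exist Mcount rho_gt0.
exists (fun x => ring_index rho (mdist x (ctr x))) => f f_iso.
have [p pP] := ctr_first _ f M0.
set z := ctr (f p) in pP *; set m := ring_index rho (mdist (f p) z).
pose e : R := m.+1%:R^-1 - m.+2%:R^-1.
have e_gt0 : 0 < e by rewrite subr_gt0 ltf_pV2 ?posrE ?ltr0Sn// ltr_nat.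
have m2_gt0 : 0 < m.+2%:R^-1 :> R by rewrite invr_gt0 ltr0Sn.
have [n [c [c0 c_step c_far]]] := walks p e e_gt0.
have start : mdist (f p) z < rho - m.+1%:R^-1 by exact/lt_ring_index/ctr_near.
have stop : rho - m.+1%:R^-1 <= mdist (f (c n)) z.
  have m1_gt0 : 0 < m.+1%:R^-1 :> R by rewrite invr_gt0 ltr0Sn.
  have := metric_triangle (f p) z (f (c n)).
  rewrite (metric_sym z) (f_iso p (c n))//.
  move: start c_far m1_gt0; set u := _^-1; lra.
have step i : (i < n)%N -> mdist (f (c i.+1)) z < mdist (f (c i)) z + e.
  move=> /c_step ci.
  have := metric_triangle (f (c i.+1)) (f (c i)) z.
  rewrite (metric_sym _ (f (c i))) (f_iso (c i) (c i.+1))//; lra.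
have [|i _ /andP[lo hi]] := @first_crossing R (fun i => mdist (f (c i)) z) n
  (rho - m.+1%:R^-1) e _ stop step; first by rewrite c0.
have {}hi : mdist (f (c i)) z < rho - m.+2%:R^-1.
  by move: hi; rewrite /e addrA subrK.
exists p, (c i).
(* The crossing point is in the ball around z, hence has the same centre z. *)
rewrite pP; last by apply: lt_trans hi _; rewrite ltrBlDr ltrDl.
exact: ring_index_eq.
Qed.

(** Colouring by the parity of the level leaves no monochromatic copy. *)
Lemma divisible_of_far_walks (R : realType) (M : metricType R) (r : R) :
  countable [set: M] -> inhabited M -> 0 < r -> far_walks M r -> divisible M.
Proof.
move=> Mcount M0 r_gt0 walks.
have [||level levelP] := @consecutive_levels R M (r / 2) Mcount M0.
- by rewrite divr_gt0.
- by rewrite mulrC divfK// pnatr_eq0.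
exists [set x | odd (level x)], [set x | ~~ odd (level x)]; split.
- by apply/seteqP; split=> // x _ /=; case: odd; [left|right].
- by apply/seteqP; split=> // x [/= ->].
- move=> [f [/levelP[p [q lev]] sub]].
  have /= := sub (f q) (ex_intro2 _ _ q I erefl).
  by rewrite lev /= (sub (f p) (ex_intro2 _ _ p I erefl)).
- move=> [f [/levelP[p [q lev]] sub]].
  have /= := sub (f q) (ex_intro2 _ _ q I erefl).
  by rewrite lev /= (sub (f p) (ex_intro2 _ _ p I erefl)).
Qed.

(** The points 0, 1/(n+1), ..., 1 of the unit interval.  The field R appears
    in the name of the type so that its metric can be inferred from the type. *)
Definition equispaced (R : realType) (n : nat) : Type := 'I_n.+2.

HB.instance Definition _ (R : realType) (n : nat) :=
  Finite.copy (equispaced R n) 'I_n.+2.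

Definition equispaced_dist (R : realType) (n : nat) (i j : equispaced R n) : R :=
  `|(i : 'I_n.+2)%:R - (j : 'I_n.+2)%:R| / n.+1%:R.

Lemma equispaced_distxx (R : realType) (n : nat) (i : equispaced R n) :
  equispaced_dist i i = 0.
Proof. by rewrite /equispaced_dist subrr normr0 mul0r. Qed.

Lemma equispaced_dist_eq0 (R : realType) (n : nat) (i j : equispaced R n) :
  equispaced_dist i j = 0 -> i = j.
Proof.
move/eqP; rewrite mulf_eq0 invr_eq0 pnatr_eq0 orbF normr_eq0 subr_eq0.
by rewrite eqr_nat => /eqP/val_inj.
Qed.

Lemma equispaced_distC (R : realType) (n : nat) (i j : equispaced R n) :
  equispaced_dist i j = equispaced_dist j i.
Proof. by rewrite /equispaced_dist distrC. Qed.

Lemma equispaced_triangle (R : realType) (n : nat) (j i k : equispaced R n) :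
  equispaced_dist i k <= equispaced_dist i j + equispaced_dist j k.
Proof.
by rewrite /equispaced_dist -mulrDl ler_pM2r ?invr_gt0 ?ltr0Sn// ler_distD.
Qed.

HB.instance Definition _ (R : realType) (n : nat) :=
  @isMetric.Build R (equispaced R n) (@equispaced_dist R n)
    (@equispaced_distxx R n) (@equispaced_dist_eq0 R n)
    (@equispaced_distC R n) (@equispaced_triangle R n).

Lemma equispaced_rational (R : realType) (n : nat) :
  distances_in rational_unit_interval (equispaced R n).
Proof.
move=> i j; split; last first.
  exists (`|(i : 'I_n.+2)%:R - (j : 'I_n.+2)%:R| / n.+1%:R).
  by rewrite fmorph_div /= ratr_norm rmorphB /= !ratr_nat.
rewrite divr_ge0//= ler_pdivrMr ?ltr0Sn// mul1r ler_norml.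
have := ltn_ord (i : 'I_n.+2); have := ltn_ord (j : 'I_n.+2).
rewrite !ltnS -!(ler_nat R).
have := ler0n R (i : 'I_n.+2); have := ler0n R (j : 'I_n.+2).
by move=> *; apply/andP; split; lra.
Qed.

(** The path embeds somewhere since it belongs to the age; homogeneity, applied
    to two singletons, then moves its first point to p. *)
Lemma Urysohn_equispaced (R : realType) (U : metricType R) (n : nat) (p : U) :
  bounded_rational_Urysohn U ->
  exists2 h : equispaced R n -> U, isometric_embedding h & h ord0 = p.
Proof.
move=> [_ Uhom Uage].
have [_ [h h_iso]] : age U (equispaced R n).
  by apply/Uage; split; [exact: finite_finset | exact: equispaced_rational].
have [||||g [g_iso _ gh]] := Uhom [set h ord0] [set p] (fun=> p).
- exact: finite_set1.
- exact: finite_set1.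
- by move=> _ _ -> ->; rewrite !mdistxx.
- by rewrite image_set1.
exists (g \o h); last exact: gh.
by move=> i j _ _ /=; rewrite g_iso// h_iso.
Qed.

Lemma Urysohn_inhabited (R : realType) (U : metricType R) :
  bounded_rational_Urysohn U -> inhabited U.
Proof.
move=> [_ _ Uage].
have [_ [h _]] : age U (equispaced R 0).
  by apply/Uage; split; [exact: finite_finset | exact: equispaced_rational].
exact: inhabits (h ord0).
Qed.

Lemma Urysohn_far_walks (R : realType) (U : metricType R) :
  bounded_rational_Urysohn U -> far_walks U 1.
Proof.
move=> UU p e e_gt0.
(* The step 1/(n+1) is then less than e. *)
pose n := Num.truncn e^-1.
have [h h_iso h0] := Urysohn_equispaced n p UU.
exists n.+1, (fun i => h (inord i)); split.
- by rewrite -h0; congr h; apply/val_inj; rewrite /= inordK.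
- move=> i lt_in; rewrite h_iso// /mdist /= /equispaced_dist.
  rewrite !inordK ?ltnS// 1?ltnW// -natr1 opprD addNKr normrN1 mul1r.
  by rewrite invf_plt ?posrE ?ltr0Sn// truncnS_gt.
- rewrite -h0 h_iso// /mdist /= /equispaced_dist.
  by rewrite inordK// sub0r normrN normr_nat divff// pnatr_eq0.
Qed.

Theorem theorem4p5 (R : realType) (U : metricType R) :
  bounded_rational_Urysohn U -> divisible U.
Proof.
move=> UU; have [Ucount _ _] := UU.
apply: (@divisible_of_far_walks R U 1) => //.
- exact: Urysohn_inhabited.
- exact: Urysohn_far_walks.
Qed.
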